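(* Let $A$ be an $n\times n$ Dyck matrix, $P$ the positroid on $[2n]$ represented by $\psi(A)$, and $\sigma$ the decorated permutation associated to $P$. Then $\sigma$ is a $2n$-cycle $(1\ j_1\ \dots\ j_{2n-1})$ satisfying: (1) in the sequence $(1,j_1,\dots,j_{2n-1})$ the elements $1,\dots,n$ appear in increasing order while the elements $n+1,\dots,2n$ appear in decreasing order; (2) for every $1\le k\le 2n-1$, the set $\{1,j_1,\dots,j_k\}$ contains at least as many elements of $\{1,\dots,n\}$ as elements of $\{n+1,\dots,2n\}$.
   Context: An $n\times n$ $0/1$ matrix is a Dyck matrix if its zero entries form a right-justified Young diagram anchored at the upper-right corner and lying strictly above the main diagonal. For an $n\times n$ real matrix $A=(a_{i,j})$, $\psi(A)$ is the $n\times 2n$ matrix whose first $n$ columns form $I_n$ and whose column $n+j$ ($j\in[n]$) has entry $(-1)^{n-i}a_{n+1-i,j}$ in row $i$. The positroid represented by $\psi(A)$ is the matroid on $[2n]$ whose bases are the $n$-subsets indexing linearly independent columns. For $i\in[2n]$, $<_i$ is the order $i<_i i+1<_i\dots<_i 2n<_i 1<_i\dots<_i i-1$, and $I_i$ is the lexicographically minimal basis with respect to $<_i$ (indices mod $2n$). The associated decorated permutation $\sigma$ is defined by: if $I_{i+1}=(I_i\setminus\{i\})\cup\{j\}$ with $j\ne i$ then $\sigma(j)=i$; if $I_{i+1}=I_i$ then $i$ is a fixed point, marked clockwise if $i\notin I_i$ and counterclockwise if $i\in I_i$. Cycle notation $(1\ j_1\ \dots\ j_{2n-1})$ means $1\mapsto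 j_1\mapsto\dots\mapsto j_{2n-1}\mapsto 1$. *)

(* Defs.v *)
From HB Require Import structures.
From mathcomp Require Import all_boot all_order all_fingroup all_algebra.
From mathcomp Require Import reals.

Set Implicit Arguments.
Unset Strict Implicit.
Unset Printing Implicit Defensive.

Import Order.TTheory GRing.Theory Num.Theory.

Local Open Scope ring_scope.

(* Indices are 0-based throughout: [n] is 'I_n, [2n] is 'I_(n + n), and the
   elements 1..n (resp. n+1..2n) of [2n] are the x with x < n (resp. n <= x). *)

(* lam i is the number of boxes in row i; right-justified, they occupy the
   columns j with n - lam i <= j. *)
Definition dyck_matrix (R : realType) (n : nat) (A : 'M[R]_n) : Prop :=
  (exists2 lam : 'I_n -> nat,
     (forall i i' : 'I_n, (i <= i')%N -> (lam i' <= lam i <= n)%N)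
   & (forall i j : 'I_n, A i j = if (n <= lam i + j)%N then 0 else 1))
  /\ (forall i j : 'I_n, A i j = 0 -> (i < j)%N).

(* With i 0-based, rev_ord i has value n - 1 - i: it is both the exponent of
   the sign and the row of A that is read. *)
Definition psi (R : realType) (n : nat) (A : 'M[R]_n) : 'M[R]_(n, n + n) :=
  row_mx 1%:M (\matrix_(i, j) ((-1) ^+ rev_ord i * A (rev_ord i) j)).

(* A matroid on 'I_m is given by its set of bases. *)
Definition represented_bases (R : realType) (n m : nat) (M : 'M[R]_(n, m)) :
    {set {set 'I_m}} :=
  [set B : {set 'I_m} | (#|B| == n) && free [seq col j M | j <- enum B]].

(* The position of a in the list i, i+1, ..., m-1, 0, ..., i-1, so that
   a <_i b if and only if cyclic_pos i a < cyclic_pos i b. *)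
Definition cyclic_pos (m : nat) (i a : 'I_m) : nat := ((a + (m - i)) %% m)%N.

Definition cyclic_seq (m : nat) (i : 'I_m) (B : {set 'I_m}) : seq nat :=
  sort leq [seq cyclic_pos i a | a <- enum B].

Definition lex_le (m : nat) (i : 'I_m) (B C : {set 'I_m}) : bool :=
  ((cyclic_seq i B : seqlexi nat) <= (cyclic_seq i C : seqlexi nat))%O.

Definition lexmin_basis (m : nat) (P : {set {set 'I_m}}) (i : 'I_m)
    (B : {set 'I_m}) : Prop :=
  B \in P /\ forall C : {set 'I_m}, C \in P -> lex_le i B C.

(* The fixed points in ccw are the counterclockwise ones; the other fixed
   points are the clockwise ones. *)
Record decorated_perm (m : nat) := DecoratedPerm {
  dperm :> {perm 'I_m};
  ccw : {set 'I_m};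
  ccw_fixed : ccw \subset [set x | dperm x == x]
}.

(* The index i + 1 mod m is ordS i. The condition i \in I i makes the two
   cases exclusive: when i \notin I i one has I (ordS i) = I i, and this set
   is also j |: (I i :\ i) for each j \in I i. *)
Definition decorated_perm_of (m : nat) (P : {set {set 'I_m}})
    (sigma : decorated_perm m) : Prop :=
  exists2 I : 'I_m -> {set 'I_m},
    (forall i, lexmin_basis P i (I i))
  & (forall i,
      (forall j, i \in I i -> j != i -> I (ordS i) = j |: (I i :\ i) ->
         sigma j = i)
      /\ (I (ordS i) = I i ->
         sigma i = i /\ (i \in ccw sigma) = (i \in I i))).

(* The element 1 of [2n]. *)
Definition first_elt (n : nat) (hn : (0 < n)%N) : 'I_(n + n) :=
  lshift n (Ordinal hn).

(* s lists the sequence (1, j_1, ..., j_(2n-1)). *)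
Definition split_monotone (n : nat) (s : seq 'I_(n + n)) : Prop :=
  sorted ltn [seq val x | x : 'I_(n + n) <- s & (x < n)%N]
  /\ sorted gtn [seq val x | x : 'I_(n + n) <- s & (n <= x)%N].

Definition ballot_prefixes (n : nat) (s : seq 'I_(n + n)) : Prop :=
  forall k : nat, (1 <= k <= (n + n).-1)%N ->
    let S := [set x in take k.+1 s] in
    (#|[set x in S | (n <= x)%N]| <= #|[set x in S | (x < n)%N]|)%N.

(* Main.v *)
(* Up to rescaling the rows by signs, the columns of [psi A] represent the cycle
   matroid of a graph on the vertices [0, ..., n]: the columns of the identity
   are the edges of the path [0 - 1 - ... - n], and column [j] of the other
   block is an edge (a "spoke") from [0] to [h j], the height of the column of
   ones, so [h] is nonincreasing with [h j >= n - j].  The lexicographically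
   minimal bases are the greedy ones, so sigma^-1 sends [i] to the first [j]
   after [i] whose edge closes a cycle through the edge [i].  Reading this off
   the graph, sigma is the successor in the cyclic list that visits the path
   edges in order and, just before the path edge [b], the spokes ending at [b]
   in decreasing order. *)
Require Import Defs.
From HB Require Import structures.
From mathcomp Require Import all_boot all_order all_fingroup all_algebra.
From mathcomp Require Import reals.
From mathcomp Require Import zify.

Set Implicit Arguments.
Unset Strict Implicit.
Unset Printing Implicit Defensive.

Import Order.TTheory GRing.Theory Num.Theory.
Local Open Scope ring_scope.

(** * Greedy bases of a vector configuration *)

Lemma cyclic_posE (m : nat) (i a : 'I_m) :
  cyclic_pos i a = (if i <= a then a - i else a + m - i)%N.
Proof.
have lti := ltn_ord i; have lta := ltn_ord a; rewrite /cyclic_pos.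
case: (leqP i a) => ?; last by rewrite modn_small; lia.
by rewrite (_ : a + (m - i) = a - i + m)%N ?modnDr ?modn_small; lia.
Qed.

Lemma cyclic_pos_lt (m : nat) (i a : 'I_m) : (cyclic_pos i a < m)%N.
Proof.
have lti := ltn_ord i; have lta := ltn_ord a; rewrite cyclic_posE.
by case: (leqP i a); lia.
Qed.

Lemma cyclic_pos_inj (m : nat) (i : 'I_m) : injective (cyclic_pos i).
Proof.
move=> a b; rewrite !cyclic_posE => eab; apply: val_inj => /=.
have lti := ltn_ord i; have lta := ltn_ord a; have ltb := ltn_ord b.
by move: eab; case: (leqP i a); case: (leqP i b); lia.
Qed.

Lemma cyclic_pos_ordS (m : nat) (i a : 'I_m) :
  cyclic_pos (ordS i) a = if a == i then m.-1 else (cyclic_pos i a).-1.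
Proof.
rewrite !cyclic_posE -val_eqE /=.
have := ltn_ord i; have := ltn_ord a => lta lti.
have [lt|ge] := ltnP i.+1 m.
  rewrite modn_small //.
  by case: (leqP i a); case: (leqP i.+1 a); case: (eqVneq (a : nat) i); lia.
have ->: (i.+1 %% m = 0)%N by rewrite (_ : i.+1 = m) ?modnn //; lia.
by case: (leqP i a); case: (eqVneq (a : nat) i) => /=; lia.
Qed.

Lemma cyclic_pos_gt0 (m : nat) (i a : 'I_m) : (0 < cyclic_pos i a)%N = (a != i).
Proof.
have {1}<- : cyclic_pos i i = 0%N by rewrite cyclic_posE leqnn subnn.
rewrite -(inj_eq (@cyclic_pos_inj m i)).
have -> : cyclic_pos i i = 0%N by rewrite cyclic_posE leqnn subnn.
by rewrite lt0n.
Qed.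

(** Both lists share the same prefix below [a]; there [s] continues with [a], while [t], having the
    same size, must continue with something larger. *)
Lemma seqlexi_le_first_diff (s t : seq nat) (a : nat) :
  sorted ltn s -> sorted ltn t -> size s = size t -> a \in s -> a \notin t ->
  (forall b, (b < a)%N -> (b \in s) = (b \in t)) ->
  ((s : seqlexi nat) <= (t : seqlexi nat))%O.
Proof.
elim: s t => [|x s IH] [|y t] //= srt_s srt_t [eq_sz] a_s a_t agree.
rewrite lexi_cons !leEnat.
have lt_s z : z \in s -> (x < z)%N.
  by move: srt_s; rewrite (path_sortedE ltn_trans) => /andP[/allP + _]; apply.
have lt_t z : z \in t -> (y < z)%N.
  by move: srt_t; rewrite (path_sortedE ltn_trans) => /andP[/allP + _]; apply.
have x_le_a : (x <= a)%N.
  by move: a_s; rewrite inE => /predU1P[->|/lt_s/ltnW].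
have [lt_yx|lt_xy|eq_xy] := ltngtP y x => //=.
  have := agree y (leq_trans lt_yx x_le_a).
  rewrite !inE eqxx /= => /orP[/eqP eq_yx|/lt_s]; lia.
subst y.
have neq_ax : a != x by apply: contraNneq a_t => ->; rewrite mem_head.
apply: IH => //; [exact: path_sorted srt_s|exact: path_sorted srt_t|..].
- by move: a_s; rewrite inE (negPf neq_ax).
- by move: a_t; rewrite inE negb_or => /andP[].
move=> b lt_ba; have := agree b lt_ba; rewrite !inE.
case: eqVneq => // -> _; apply/idP/idP => [/lt_s|/lt_t]; lia.
Qed.

Section Greedy.
Variables (K : fieldType) (V : vectType K) (m : nat) (v : 'I_m -> V).
Implicit Types (B C : {set 'I_m}) (a b i j : 'I_m).

Definition set_span B : {vspace V} := <<[seq v b | b <- enum B]>>%VS.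

Lemma mem_set_span B b : b \in B -> v b \in set_span B.
Proof. by move=> bB; rewrite memv_span // map_f // mem_enum. Qed.

Lemma set_spanS B C : B \subset C -> (set_span B <= set_span C)%VS.
Proof.
move=> /subsetP sBC; apply: sub_span => _ /mapP[b bB ->].
by rewrite map_f // mem_enum sBC // -mem_enum.
Qed.

Lemma enum_setU1 B a : a \notin B -> perm_eq (enum (a |: B)) (a :: enum B).
Proof.
move=> aB; apply: uniq_perm; rewrite ?enum_uniq //=.
  by rewrite enum_uniq mem_enum aB.
by move=> b; rewrite mem_enum !inE mem_enum.
Qed.

Lemma set_spanU1 B a : set_span (a |: B) = (<[v a]> + set_span B)%VS.
Proof.
have [aB|aB] := boolP (a \in B); last first.
  rewrite /set_span -span_cons; apply/eq_span/perm_mem.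
  exact: perm_map (enum_setU1 aB).
rewrite (setUidPr _) ?sub1set //; apply/esym/addv_idPr.
by rewrite -memvE mem_set_span.
Qed.

Lemma free_setU1 B a : a \notin B ->
  free [seq v b | b <- enum (a |: B)]
  = (v a \notin set_span B) && free [seq v b | b <- enum B].
Proof.
by move=> aB; rewrite (perm_free (perm_map v (enum_setU1 aB))) free_cons.
Qed.

(** The coefficient of [v b] in [v a] cannot vanish, so the relation can be solved for [v b]. *)
Lemma set_span_exchange B a b :
  v a \in set_span (b |: B) -> v a \notin set_span B ->
  v b \in set_span (a |: B).
Proof.
rewrite !set_spanU1 => /memv_addP[_ /vlineP[k ->] [w wB eq_a]].
have [k0|k0] := eqVneq k 0.
  by move: eq_a; rewrite k0 scale0r add0r => ->; rewrite wB.
have -> : v b = k^-1 *: v a - k^-1 *: w.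
  by rewrite eq_a scalerDr scalerA mulVf // scale1r addrK.
by rewrite memv_add ?memvN ?memvZ ?memv_line.
Qed.

(** The test is against all earlier elements, not only those kept; [greedy_below] shows that both
    have the same span. *)
Definition greedy i : {set 'I_m} :=
  [set a | v a \notin set_span [set b | (cyclic_pos i b < cyclic_pos i a)%N]].

Let below i k : {set 'I_m} := [set b | (cyclic_pos i b < k)%N].

Lemma greedy_below i k :
  set_span (greedy i :&: below i k) = set_span (below i k)
  /\ free [seq v b | b <- enum (greedy i :&: below i k)].
Proof.
elim: k => [|k [IHs IHf]].
  have -> : below i 0 = set0 by apply/setP => b; rewrite !inE.
  by rewrite setI0 /set_span enum_set0 /= span_nil nil_free.
(* For [k >= m] no element has position [k], and [below] has stopped growing. *)
have [a /eqP pos_a|no_a] := pickP [pred a | cyclic_pos i a == k]; last first.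
  suff -> : below i k.+1 = below i k by [].
  by apply/setP => b; rewrite !inE ltnS leq_eqVlt; have /= -> := no_a b.
have below_a : below i k.+1 = a |: below i k.
  apply/setP => b; rewrite !inE ltnS leq_eqVlt -{1}pos_a.
  by rewrite (inj_eq (@cyclic_pos_inj _ _)).
have a_below : a \notin below i k by rewrite inE pos_a ltnn.
rewrite below_a.
have greedy_a : (a \in greedy i) = (v a \notin set_span (below i k)).
  by rewrite inE pos_a.
have [aG|aG] := boolP (a \in greedy i).
  have -> : greedy i :&: (a |: below i k) = a |: (greedy i :&: below i k).
    by rewrite setIUr (setIidPr _) ?sub1set.
  rewrite !set_spanU1 free_setU1 ?inE ?(negPf a_below) ?andbF //; last first.
    by rewrite pos_a ltnn andbF.
  by rewrite IHs -greedy_a aG.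
have -> : greedy i :&: (a |: below i k) = greedy i :&: below i k.
  rewrite setIUr (_ : greedy i :&: [set a] = set0) ?set0U //.
  by apply/eqP; rewrite setI_eq0 disjoint_sym disjoints1.
rewrite IHs set_spanU1; split=> //; apply/esym/addv_idPr.
by move: aG; rewrite greedy_a negbK.
Qed.

Lemma below_top i : below i m = setT.
Proof. by apply/setP => b; rewrite !inE cyclic_pos_lt. Qed.

Lemma greedy_free i : free [seq v b | b <- enum (greedy i)].
Proof. by have [_] := greedy_below i m; rewrite below_top setIT. Qed.

Lemma greedy_span i : set_span (greedy i) = set_span setT.
Proof. by have [] := greedy_below i m; rewrite below_top setIT. Qed.

Lemma cyclic_seq_sorted i B : sorted ltn (cyclic_seq i B).
Proof.
rewrite ltn_sorted_uniq_leq sort_uniq sort_sorted; last exact: leq_total.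
by rewrite (map_inj_uniq (@cyclic_pos_inj m i)) enum_uniq.
Qed.

Lemma mem_cyclic_seq i B a : (cyclic_pos i a \in cyclic_seq i B) = (a \in B).
Proof. by rewrite mem_sort (mem_map (@cyclic_pos_inj m i)) mem_enum. Qed.

Lemma cyclic_seqP i B k :
  reflect (exists2 a, a \in B & k = cyclic_pos i a) (k \in cyclic_seq i B).
Proof.
rewrite mem_sort; apply: (iffP mapP) => -[a aB ->]; exists a => //.
  by rewrite -mem_enum.
by rewrite mem_enum.
Qed.

(** At the first element [a] where the two sets differ, [a] must be greedy. Otherwise [a] is in [C],
    and [v a] is spanned by earlier greedy elements, which all lie in [C], so [C] is not free. *)
Lemma greedy_lex_le i C :
  free [seq v b | b <- enum C] -> #|C| = #|greedy i| -> lex_le i (greedy i) C.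
Proof.
move=> freeC cardC; rewrite /lex_le.
have [-> //|neqCG] := eqVneq C (greedy i).
pose D := [set a | (a \in C) != (a \in greedy i)].
have [a0 a0D] : exists a, a \in D.
  apply/set0Pn; apply: contraNneq neqCG => /setP D0; apply/eqP/setP => a.
  by have := D0 a; rewrite !inE => /negbFE/eqP.
case: (@arg_minnP _ a0 (mem D) (cyclic_pos i) a0D) => a aD a_min.
have agree b : (cyclic_pos i b < cyclic_pos i a)%N ->
    (b \in C) = (b \in greedy i).
  move=> lt_ba; apply/eqP; apply: contraTT lt_ba => neq_b.
  by rewrite -leqNgt; apply: a_min; rewrite /= inE.
have [aG|aG] := boolP (a \in greedy i).
  have aC : a \notin C by move: aD; rewrite /= inE aG; case: (a \in C).
  apply: (@seqlexi_le_first_diff _ _ (cyclic_pos i a)).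
  - exact: cyclic_seq_sorted.
  - exact: cyclic_seq_sorted.
  - by rewrite !size_sort !size_map -!cardE cardC.
  - by rewrite mem_cyclic_seq.
  - by rewrite mem_cyclic_seq.
  move=> k lt_ka; apply/cyclic_seqP/cyclic_seqP => -[b bB eq_k]; exists b => //.
    by rewrite agree // -eq_k.
  by rewrite -agree // -eq_k.
have aC : a \in C by move: aD; rewrite /= inE (negPf aG); case: (a \in C).
have := freeC; rewrite -(setD1K aC) free_setU1 ?setD11 // => /andP[/negP[]].
move: aG; rewrite inE negbK -(greedy_below i _).1; apply: subvP.
apply: set_spanS; apply/subsetP => b; rewrite inE => /andP[bG].
rewrite !inE => lt_ba; rewrite agree // bG andbT.
by apply: contraTneq lt_ba => ->; rewrite ltnn.
Qed.

Lemma lex_le_anti i B C : lex_le i B C -> lex_le i C B -> B = C.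
Proof.
move=> leBC leCB; have eqBC : cyclic_seq i B = cyclic_seq i C.
  by apply: (@le_anti _ (seqlexi nat)); apply/andP; split.
by apply/setP => a; rewrite -!(mem_cyclic_seq i) eqBC.
Qed.

(** Here [j] is the first element after [i] that closes a dependency through [i]. Moving [i] to the
    end makes [i] redundant and [j] necessary; the status of every other element is unchanged. *)
Lemma greedy_ordS i j : j != i ->
  v i \in set_span [set b | 0 < cyclic_pos i b <= cyclic_pos i j]%N ->
  v i \notin set_span [set b | 0 < cyclic_pos i b < cyclic_pos i j]%N ->
  [/\ i \in greedy i, j \notin greedy i
    & greedy (ordS i) = j |: (greedy i :\ i)].
Proof.
move=> neq_ji span_le span_lt.
(* The elements before [b0] are [i |: upto b0] in the order from [i], and [upto b0] in the order
   from [ordS i]. *)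
pose upto b0 := [set b | 0 < cyclic_pos i b < cyclic_pos i b0]%N.
have pos_ii : cyclic_pos i i = 0%N.
  by apply/eqP; rewrite -leqn0 leqNgt cyclic_pos_gt0 eqxx.
have pos_j : (0 < cyclic_pos i j)%N by rewrite cyclic_pos_gt0.
have upto_le b : [set c | 0 < cyclic_pos i c <= cyclic_pos i b]%N \subset b |: upto b.
  apply/subsetP => c; rewrite !inE => /andP[-> /=].
  by rewrite leq_eqVlt (inj_eq (@cyclic_pos_inj m i)).
have greedyE b : b != i -> (b \in greedy i) = (v b \notin set_span (i |: upto b)).
  move=> neq_bi; rewrite inE; congr (_ \notin set_span _).
  apply/setP => c; rewrite !inE cyclic_pos_gt0.
  by case: eqVneq => [->|] //=; rewrite pos_ii cyclic_pos_gt0.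
have greedySE b : b != i ->
    (b \in greedy (ordS i)) = (v b \notin set_span (upto b)).
  move=> neq_bi; rewrite inE; congr (_ \notin set_span _).
  apply/setP => c; rewrite !inE !cyclic_pos_ordS (negPf neq_bi).
  have := cyclic_pos_gt0 i c; have := cyclic_pos_gt0 i b.
  rewrite neq_bi; have := cyclic_pos_lt i b.
  by case: eqVneq => [->|_]; rewrite ?pos_ii; lia.
have span_j : v i \in set_span (j |: upto j).
  exact: subvP (set_spanS (upto_le j)) _ span_le.
have ij : i \in greedy i.
  rewrite inE pos_ii (_ : [set _ | _] = set0); last first.
    by apply/setP => b; rewrite !inE.
  apply: contra span_lt; apply: subvP; exact/set_spanS/sub0set.
have jS : v j \notin set_span (upto j).
  apply: contra span_lt => vj; move: span_j; rewrite set_spanU1.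
  by rewrite (addv_idPr _).
have jG : j \notin greedy i by rewrite greedyE // negbK set_span_exchange.
split=> //; apply/setP => b; rewrite !inE -/(upto b).
have [->|neq_bi] := eqVneq b i.
  rewrite /= orbF eq_sym (negPf neq_ji); apply/negbTE; rewrite negbK.
  apply: subvP (set_spanS _) _ span_le; apply/subsetP => c; rewrite !inE.
  rewrite !cyclic_pos_ordS eqxx => /andP[pos_c _].
  have /negPf-> : c != i by rewrite -cyclic_pos_gt0.
  by have := cyclic_pos_lt i c; lia.
have := greedySE b neq_bi; have := greedyE b neq_bi; rewrite !inE => -> ->.
have [->|neq_bj] := eqVneq b j; first by rewrite jS.
rewrite andTb orFb; congr (~~ _).
have [lt_jb|le_bj] := ltnP (cyclic_pos i j) (cyclic_pos i b).
  rewrite set_spanU1 (addv_idPr _) //.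
  apply: subvP (set_spanS _) _ span_le; apply/subsetP => c; rewrite !inE.
  by case/andP=> -> /leq_ltn_trans ->.
apply/idP/idP.
  by apply: subvP; apply/set_spanS/subsetUr.
(* If [v b] depended on [v i], exchange would put [v i] in the span of the elements after [i] up to
   [b], all strictly before [j]. *)
move=> vb; apply: contraTT span_lt => vbS; rewrite negbK.
have := set_span_exchange vb vbS; apply: subvP; apply/set_spanS/subsetP => c.
have lt_bj : (cyclic_pos i b < cyclic_pos i j)%N.
  by rewrite ltn_neqAle le_bj (inj_eq (@cyclic_pos_inj m i)) neq_bj.
rewrite !inE => /predU1P[->|/andP[-> /ltn_trans -> //]].
by rewrite cyclic_pos_gt0 neq_bi.
Qed.

End Greedy.

(** * The decorated permutation of a represented positroid *)

Section RepresentedPositroid.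
Variables (R : realType) (n m : nat) (M : 'M[R]_(n, m)).
Let v := fun i : 'I_m => col i M.
Hypothesis M_full : set_span v setT = fullv.

Lemma greedy_lexmin i : lexmin_basis (represented_bases M) i (greedy v i).
Proof.
have cardG : #|greedy v i| = n.
  have : basis_of fullv [seq v b | b <- enum (greedy v i)].
    by rewrite /basis_of greedy_free andbT -M_full -(greedy_span v i).
  by move=> /size_basis <-; rewrite dimvf /dim /= muln1.
split; first by rewrite inE cardG eqxx greedy_free.
move=> C; rewrite inE => /andP[/eqP cardC freeC].
by apply: greedy_lex_le freeC _; rewrite cardC cardG.
Qed.

(** Antisymmetry of the lexicographic order forces every [I i] to be the greedy basis. Then
    [greedy_ordS] determines the permutation, and without fixed points no marking is left to
    choose. *)
Lemma unique_decorated_perm_of (sigma : {perm 'I_m}) :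
  (forall j, sigma j != j) ->
  (forall i j, sigma j = i ->
     v i \in set_span v [set b | 0 < cyclic_pos i b <= cyclic_pos i j]%N) ->
  (forall i j, sigma j = i ->
     v i \notin set_span v [set b | 0 < cyclic_pos i b < cyclic_pos i j]%N) ->
  exists2 ds : decorated_perm m,
    unique (decorated_perm_of (represented_bases M)) ds & dperm ds = sigma.
Proof.
move=> no_fix span_le span_lt.
have ccw_fix : set0 \subset [set x | sigma x == x] by rewrite sub0set.
have step j : [/\ sigma j \in greedy v (sigma j), j \notin greedy v (sigma j)
    & greedy v (ordS (sigma j)) = j |: (greedy v (sigma j) :\ sigma j)].
  by apply: greedy_ordS; rewrite 1?eq_sym ?no_fix ?span_le ?span_lt.
exists (DecoratedPerm ccw_fix) => //; split.
  exists (greedy v); first exact: greedy_lexmin.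
  move=> i; rewrite -(permKV sigma i); set j0 := (sigma^-1)%g i.
  have [iG jG eqS] := step j0; split=> [j _ neq_j|]; rewrite eqS.
    (* [j0] enters the next basis without being in the current one, so it can only be the added
       element [j]. *)
    move=> /setP/(_ j0); rewrite setU11 in_setU1 in_setD1 (negPf jG) andbF orbF.
    by move/esym/eqP <-.
  by move=> /setP/(_ j0); rewrite setU11 (negPf jG).
move=> [tau fx fx_sub] [I I_min I_tau] /=.
have IE i : I i = greedy v i.
  have [IP Imin] := I_min i; have [GP Gmin] := greedy_lexmin i.
  exact: lex_le_anti (Imin _ GP) (Gmin _ IP).
have tauE : tau = sigma.
  apply/permP => j; have [iG jG eqS] := step j.
  have [+ _] := I_tau (sigma j); apply; rewrite ?IE //.
  by rewrite eq_sym no_fix.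
subst tau.
have fx0 : fx = set0.
  apply/setP => x; rewrite [RHS]inE; apply/negbTE/negP => /(subsetP fx_sub).
  by rewrite inE (negPf (no_fix x)).
by subst fx; congr DecoratedPerm; apply: bool_irrelevance.
Qed.

End RepresentedPositroid.

(** The first alternative is an ordinary step to the next larger key; the second is the wrap-around
    from the last element to the head. *)
Lemma next_sorted_key (T : eqType) (key : T -> nat) (s : seq T) (x : T) :
  sorted ltn (map key s) -> x \in s ->
  (key x < key (next s x)
     /\ {in s, forall z, key z < key (next s x) -> key z <= key x})%N
  \/ {in s, forall z, key (next s x) <= key z <= key x}%N.
Proof.
move=> srt xs; have uniq_s : uniq s.
  by apply: map_uniq (sorted_uniq ltn_trans ltnn srt).
have key_ltn a b : (a < b < size s)%N ->
    (key (nth x s a) < key (nth x s b))%N.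
  move=> /andP[lt_ab lt_b]; rewrite -!(nth_map x 0%N) //; last lia.
  by apply: (sorted_ltn_nth ltn_trans) => //; rewrite inE size_map; lia.
have key_leq a b : (a <= b < size s)%N ->
    (key (nth x s a) <= key (nth x s b))%N.
  move=> /andP[]; rewrite leq_eqVlt => /predU1P[-> //|lt_ab lt_b].
  by apply/ltnW/key_ltn/andP.
have lt_x : (index x s < size s)%N by rewrite index_mem.
have eq_x := nth_index x xs.
have [last_x|mid_x] := leqP (size s) (index x s).+1.
  right=> z zs; have lt_z : (index z s < size s)%N by rewrite index_mem.
  (* [next_nth] reads the tail with the head as default value, so reading past the end returns the
     head. *)
  have -> : next s x = nth x s 0.
    rewrite next_nth xs; case: (s) last_x lt_x => //= y p le_p lt_p.
    by rewrite nth_default //; lia.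
  have := key_leq 0%N (index z s); have := key_leq (index z s) (index x s).
  by rewrite eq_x nth_index //; lia.
left; have -> : next s x = nth x s (index x s).+1.
  rewrite next_nth xs; case: (s) mid_x => //= y p lt_p.
  by apply: set_nth_default; lia.
split=> [|z zs].
  by have := key_ltn (index x s) (index x s).+1; rewrite eq_x; lia.
have lt_z : (index z s < size s)%N by rewrite index_mem.
have := key_leq (index z s) (index x s).
have := key_leq (index x s).+1 (index z s).
by rewrite eq_x nth_index //; lia.
Qed.

(** * The cyclic order of the edges *)

Section NecklaceOrder.
Variables (n : nat) (h : nat -> nat).
Hypothesis h_le : forall t, (h t <= n)%N.
Hypothesis h_ge : forall t, (t < n -> n - t <= h t)%N.
Hypothesis h_mono : forall t t', (t <= t' -> h t' <= h t)%N.

(* Increasing keys list the path edges [0], ..., [n - 1] in order, with the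
   spokes ending at the vertex [b] just after the path edge [b - 1]. *)
Definition key (x : nat) : nat :=
  if (x < n)%N then (x.+1 * n.+1)%N else (h (x - n) * n.+1 + (n + n - x))%N.

Lemma key_lt_path (x y : nat) : (x < n)%N -> (y < n)%N ->
  (key x < key y)%N = (x < y)%N.
Proof. by move=> ltx lty; rewrite /key ltx lty ltn_mul2r. Qed.

(** The offset [n + n - y] lies between [1] and [n]: it never reaches the next multiple of [n.+1],
    and it breaks ties in favour of the path edge. *)
Lemma key_lt_path_spoke (x y : nat) : (x < n)%N -> (n <= y < n + n)%N ->
  (key x < key y)%N = (x < h (y - n))%N.
Proof.
move=> ltx /andP[ley lty]; rewrite /key ltx (leq_gtF ley).
case: (ltnP x (h (y - n))) => hx.
  by have := leq_mul hx (leqnn n.+1); lia.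
by have := leq_mul hx (leqnn n.+1); lia.
Qed.

Lemma key_lt_spoke_path (x y : nat) : (n <= x)%N -> (y < n)%N ->
  (key x < key y)%N = (h (x - n) <= y)%N.
Proof.
move=> lex lty; rewrite /key lty (leq_gtF lex).
case: (leqP (h (x - n)) y) => hy.
  by have := leq_mul hy (leqnn n.+1); lia.
by have := leq_mul hy (leqnn n.+1); lia.
Qed.

(** As the index grows, the height does not increase and the offset strictly decreases. *)
Lemma key_lt_spoke (x y : nat) : (n <= x)%N -> (n <= y)%N -> (x < n + n)%N ->
  (key x < key y)%N = (y < x)%N.
Proof.
move=> lex ley ltx; rewrite /key (leq_gtF lex) (leq_gtF ley).
case: (ltnP y x) => [lt_yx|le_xy].
  have hxy : (h (x - n) <= h (y - n))%N by apply: h_mono; lia.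
  by have := leq_mul hxy (leqnn n.+1); lia.
have hyx : (h (y - n) <= h (x - n))%N by apply: h_mono; lia.
by have := leq_mul hyx (leqnn n.+1); lia.
Qed.

Lemma key_inj : injective (fun x : 'I_(n + n) => key x).
Proof.
move=> x y /= exy; apply: val_inj => /=.
have : ~~ (key x < key y)%N by rewrite exy ltnn.
have : ~~ (key y < key x)%N by rewrite exy ltnn.
have ltx := ltn_ord x; have lty := ltn_ord y.
case: (ltnP x n) => nx; case: (ltnP y n) => ny.
- by rewrite !key_lt_path //; lia.
- by rewrite (key_lt_path_spoke nx) ?(key_lt_spoke_path ny) ?ny //; lia.
- by rewrite (key_lt_path_spoke ny) ?(key_lt_spoke_path nx) ?nx //; lia.
by rewrite !key_lt_spoke //; lia.
Qed.

Definition necklace : seq 'I_(n + n) :=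
  sort (relpre (fun x : 'I_(n + n) => key x) leq) (enum 'I_(n + n)).

Lemma mem_necklace x : x \in necklace.
Proof. by rewrite mem_sort mem_enum. Qed.

Lemma necklace_uniq : uniq necklace.
Proof. by rewrite sort_uniq enum_uniq. Qed.

Lemma size_necklace : size necklace = (n + n)%N.
Proof. by rewrite size_sort -cardE card_ord. Qed.

Lemma necklace_sorted : sorted ltn [seq key x | x : 'I_(n + n) <- necklace].
Proof.
rewrite ltn_sorted_uniq_leq map_inj_uniq ?necklace_uniq //=; last exact: key_inj.
by rewrite sorted_map; apply: sort_sorted => x y; apply: leq_total.
Qed.

Definition necklace_perm : {perm 'I_(n + n)} :=
  perm (can_inj (prev_next necklace_uniq)).

(* [j] is the first edge after [i] in cyclic order that closes a cycle through
   [i]; which one it is depends on whether [i] and [j] are path edges or spokes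
   and, if [i] is a path edge, on whether some spoke ends at the vertex [i]. *)
Lemma necklace_perm_cases (n_gt0 : (0 < n)%N) (i j : 'I_(n + n)) :
  necklace_perm j = i ->
  (i = 0%N :> nat) /\ (j = n :> nat) \/
  [\/ [/\ (0 < i < n)%N, i = j.+1 :> nat
        & forall x : 'I_(n + n), (n <= x)%N -> h (x - n) <> i],
      [/\ (0 < i < n)%N, (n <= j)%N, h (j - n) = i
        & forall x : 'I_(n + n), (n <= x)%N -> h (x - n) = i -> (j <= x)%N],
      [/\ (n <= i)%N, j = i.+1 :> nat & h (j - n) = h (i - n)]
    | [/\ (n <= i)%N, (j < n)%N, j.+1 = h (i - n)
        & forall x : 'I_(n + n), (i < x)%N -> h (x - n) <> h (i - n)]].
Proof.
rewrite permE => nji.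
have := next_sorted_key necklace_sorted (mem_necklace j).
rewrite nji; have lti := ltn_ord i; have ltj := ltn_ord j.
have lt_n : (n < n + n)%N by lia.
(* In the wrap-around, [i] has the least key and [j] the greatest; comparison with the path edge [0]
   and the spoke [n] identifies them. *)
case=> [[lt_ji max_j]|max_j]; last first.
  have /andP[le0 _] := max_j (first_elt n_gt0) (mem_necklace _).
  have /andP[_ len] := max_j (Ordinal lt_n) (mem_necklace _).
  left; split.
    move: le0; rewrite leqNgt /=; have [ltin|lein] := ltnP i n.
      by rewrite key_lt_path //; lia.
    by rewrite key_lt_path_spoke ?lein //; have := @h_ge (i - n); lia.
  move: len; rewrite leqNgt /=; have [ltjn|lejn] := ltnP j n.
    by rewrite key_lt_path_spoke ?leqnn // subnn; have := h_ge n_gt0; lia.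
  by rewrite key_lt_spoke //; lia.
have {}max_j (x : 'I_(n + n)) : (key x < key i)%N -> ~~ (key j < key x)%N.
  by move=> lt_xi; rewrite -leqNgt; apply: max_j lt_xi; apply: mem_necklace.
have max_lt x (lt_x : (x < n + n)%N) := max_j (Ordinal lt_x).
(* Each case tests an edge that must not lie strictly between [j] and [i]: the path edge [i.-1] if
   [i] is a path edge, the path edge ending at [h (i - n)] or the spoke [i.+1] if [i] is a spoke. *)
right; have [ltin|leni] := ltnP i n; have [ltjn|lenj] := ltnP j n.
- have lt_ji' : (j < i)%N by move: lt_ji; rewrite key_lt_path.
  have lt_p : (i.-1 < n + n)%N by lia.
  have := max_lt _ lt_p; rewrite /= !key_lt_path ?prednK //; [|lia..].
  move=> ij; constructor 1; split; [lia|lia|] => x lex hx.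
  have := max_j x; rewrite key_lt_spoke_path // hx leqnn => /(_ isT).
  by rewrite key_lt_path_spoke ?lex ?ltn_ord // hx lt_ji'.
- have hj_le : (h (j - n) <= i)%N by move: lt_ji; rewrite key_lt_spoke_path.
  have hj_gt0 : (0 < h (j - n))%N by have := @h_ge (j - n); lia.
  have lt_p : (i.-1 < n + n)%N by lia.
  have := max_lt _ lt_p; rewrite /= key_lt_path ?key_lt_spoke_path //; [|lia..].
  move=> hj; have {}hj : h (j - n) = i by lia.
  constructor 2; split; [lia|lia|lia|] => x lex hx.
  have := max_j x; rewrite key_lt_spoke_path // hx leqnn => /(_ isT).
  by rewrite key_lt_spoke // -leqNgt.
- have lt_jh : (j < h (i - n))%N.
    by move: lt_ji; rewrite key_lt_path_spoke ?leni.
  have hin := h_le (i - n).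
  have lt_p : ((h (i - n)).-1 < n + n)%N by lia.
  have := max_lt _ lt_p.
  rewrite /= (key_lt_path ltjn) ?key_lt_path_spoke ?leni //; [|lia..].
  move=> hj; have {}hj : j.+1 = h (i - n) by lia.
  constructor 4; split=> // x lt_ix hx.
  have lenx : (n <= x)%N by lia.
  have := max_j x; rewrite key_lt_spoke // lt_ix => /(_ isT).
  by rewrite key_lt_path_spoke ?lenx ?ltn_ord // hx lt_jh.
have lt_ij : (i < j)%N by move: lt_ji; rewrite key_lt_spoke.
have lt_S : (i.+1 < n + n)%N by lia.
have lenS : (n <= i.+1)%N by lia.
have := max_lt _ lt_S; rewrite /= !key_lt_spoke // ltnSn => /(_ isT) ji.
constructor 3; split; [by []|lia|].
have hin := h_le (i - n); have := @h_ge (i - n) => hi.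
(* If [h (j - n)] were smaller than [h (i - n)], this path edge would separate the two spokes. *)
have lt_p : ((h (i - n)).-1 < n + n)%N by lia.
have := max_lt _ lt_p; rewrite /= key_lt_path_spoke ?key_lt_spoke_path ?leni //; [|lia..].
by have := @h_mono (i - n) (j - n); lia.
Qed.

Lemma necklace_split_monotone : split_monotone necklace.
Proof.
have srt P : sorted (fun x y : 'I_(n + n) => (key x < key y)%N)
    [seq x <- necklace | P x].
  apply: sorted_filter => [x y z|]; first exact: ltn_trans.
  by have := necklace_sorted; rewrite sorted_map.
split; rewrite sorted_map.
  apply: (sub_in_sorted (P := [pred x : 'I_(n + n) | x < n]%N)) (srt _).
    by move=> x y /= ltx lty; rewrite key_lt_path.
  by apply/allP => x; rewrite mem_filter => /andP[].
apply: (sub_in_sorted (P := [pred x : 'I_(n + n) | n <= x]%N)) (srt _).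
  by move=> x y /= lex ley; rewrite key_lt_spoke.
by apply/allP => x; rewrite mem_filter => /andP[].
Qed.

(* [x |-> 2n - 1 - x] sends the elements [>= n] to elements [< n] that come
   before them in the necklace. *)
Lemma necklace_ballot : ballot_prefixes necklace.
Proof.
move=> k k_lt /=.
have lt_k : (k < size necklace)%N by rewrite size_necklace; lia.
set S := [set x in take k.+1 necklace].
(* A prefix of a list sorted by [key] is closed under passing to smaller keys. *)
have closed (x y : 'I_(n + n)) : y \in S -> (key x < key y)%N -> x \in S.
  rewrite !inE => yS; apply: contraTT => xS; rewrite -leqNgt ltnW //.
  have := necklace_sorted; rewrite -{1}(cat_take_drop k.+1 necklace) map_cat.
  rewrite (sorted_pairwise ltn_trans) pairwise_cat => /and3P[/allrelP lt_td _ _].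
  apply: lt_td; apply: map_f => //.
  have := mem_necklace x; rewrite -{1}(cat_take_drop k.+1 necklace) mem_cat.
  by rewrite (negPf xS).
rewrite -(card_imset _ (@rev_ord_inj (n + n))); apply: subset_leq_card.
apply/subsetP => _ /imsetP[x + ->]; rewrite 2!inE => /andP[xS lex].
have ltx := ltn_ord x.
have lt_rx : (n + n - x.+1 < n)%N by lia.
(* This amounts to [n + n - x <= h (x - n)], which is [h_ge]. *)
have key_rx : (key (rev_ord x) < key x)%N.
  by rewrite key_lt_path_spoke ?lex //=; have := @h_ge (x - n); lia.
by have := closed _ _ xS key_rx; rewrite !inE /= lt_rx andbT.
Qed.

End NecklaceOrder.

(** * The graph of a Dyck matrix *)

Section DyckColumns.
Variables (R : realType) (n : nat) (h : nat -> nat) (A : 'M[R]_n).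
Hypothesis n_gt0 : (0 < n)%N.
Hypothesis h_le : forall t, (h t <= n)%N.
Hypothesis h_ge : forall t, (t < n -> n - t <= h t)%N.
Hypothesis h_mono : forall t t', (t <= t' -> h t' <= h t)%N.
Hypothesis A_h : forall i j : 'I_n, A (rev_ord i) j = (i < h j)%N%:R.

Let v := fun x : 'I_(n + n) => col x (psi A).

Definition nat_col (f : nat -> R) : 'cV[R]_n := \col_(k < n) f k.

(* Up to signs, the column of the edge joining [0] to [b], and the sum of the
   columns of the edges [x], joining [x] to [x.+1], for [x < b]. *)
Definition spoke (b : nat) : 'cV[R]_n :=
  nat_col (fun k => if (k < b)%N then (-1) ^+ (n - k.+1) else 0).

Lemma col_psi_path (x : 'I_(n + n)) : (x < n)%N ->
  v x = nat_col (fun k => (k == x :> nat)%:R).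
Proof.
move=> ltx; apply/colP => k; rewrite !mxE; case: split_ordP => y eq_x.
  by rewrite !mxE eq_x.
by move: ltx; rewrite eq_x /=; lia.
Qed.

Lemma col_psi_spoke (x : 'I_(n + n)) : (n <= x)%N -> v x = spoke (h (x - n)).
Proof.
move=> lex; apply/colP => k; rewrite !mxE; case: split_ordP => y eq_x.
  by move: lex; rewrite eq_x /=; have := ltn_ord y; lia.
rewrite !mxE A_h eq_x /= addKn; case: ltnP => _; first by rewrite mulr1.
by rewrite mulr0.
Qed.

Lemma col_psi_full : set_span v setT = fullv.
Proof.
apply/vspaceP => c; rewrite memvf [c]matrix_sum_delta memv_suml // => k _; rewrite big_ord1 memvZ //.
have ltk : (lshift n k < n)%N by rewrite /= ltn_ord.
have -> : delta_mx k 0 = v (lshift n k).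
  by rewrite col_psi_path //; apply/colP => l; rewrite !mxE eqxx andbT.
by rewrite mem_set_span ?inE.
Qed.

Lemma spoke0 : spoke 0 = 0.
Proof. by apply/colP => k; rewrite !mxE. Qed.

(** [spoke a] and [spoke b] differ by a signed sum of the path columns from [a] to [b - 1]. *)
Lemma mem_spoke (U : {vspace 'cV[R]_n}) (a b : nat) :
  (a <= b <= n)%N ->
  (forall x : 'I_(n + n), (a <= x < b)%N -> v x \in U) ->
  (spoke a \in U) = (spoke b \in U).
Proof.
move=> /andP[]; elim: b => [|b IH]; first by rewrite leqn0 => /eqP->.
rewrite leq_eqVlt => /predU1P[-> //|]; rewrite ltnS => le_ab lt_bn pathU.
rewrite IH //; [|lia|by move=> x lt_x; apply: pathU; lia].
have lt_b : (b < n + n)%N by lia.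
have -> : spoke b.+1 = spoke b + (-1) ^+ (n - b.+1) *: v (Ordinal lt_b).
  rewrite col_psi_path //; apply/colP => k; rewrite !mxE ltnS leq_eqVlt.
  by case: (ltngtP (k : nat) b) => /= [||->]; rewrite ?mulr0 ?mulr1 ?addr0 ?add0r.
by rewrite rpredDr // memvZ // pathU //= le_ab ltnSn.
Qed.

(** The path edge [x] and the spokes to its two ends form a triangle, degenerate for [x = 0], where
    [spoke 0] is zero. *)
Lemma path_mem_spoke (U : {vspace 'cV[R]_n}) (x : 'I_(n + n)) : (x < n)%N ->
  spoke x \in U -> spoke x.+1 \in U -> v x \in U.
Proof.
move=> ltx Ux UxS.
have -> : v x = (-1) ^+ (n - x.+1) *: (spoke x.+1 - spoke x).
  rewrite col_psi_path //; apply/colP => k; rewrite !mxE ltnS leq_eqVlt.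
  case: (ltngtP (k : nat) x) => /= [_|_|->]; rewrite ?subrr ?mulr0 ?subr0 //.
  by rewrite -expr2 sqrr_sign.
by rewrite memvZ ?memvB.
Qed.

(** The value [0] outside the range lets [cut_row n] describe the end vertex [n], which meets only
    one path edge. *)
Definition coord_row (k : nat) : 'rV[R]_n :=
  if insub k is Some l then delta_mx 0 l else 0.

Lemma coord_row_mul k f :
  (coord_row k *m nat_col f) 0 0 = if (k < n)%N then f k else 0.
Proof.
rewrite /coord_row; case: insubP => [l ltk <-|/negPf->].
  by rewrite ltn_ord -rowE !mxE.
by rewrite mul0mx mxE.
Qed.

(** A linear form that kills the columns of [B] has their span in its kernel. *)
Lemma set_span_separated (B : {set 'I_(n + n)}) (i : 'I_(n + n)) (r : 'rV[R]_n) :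
  (forall b, b \in B -> (r *m v b) 0 0 = 0) -> (r *m v i) 0 0 != 0 ->
  v i \notin set_span v B.
Proof.
move=> rB; apply: contra => vi.
suff : v i \in lker (linfun (mulmx r)).
  by rewrite memv_ker lfunE /= => /eqP->; rewrite mxE.
apply: subvP vi; apply/span_subvP => _ /mapP[b bB ->].
rewrite memv_ker lfunE /=; apply/eqP/matrixP => p q; rewrite !ord1 rB ?mxE //.
by rewrite -mem_enum.
Qed.

(* Up to signs, this form is the cut of the graph separating the vertex [u]
   from the others. *)
Definition cut_row (u : nat) : 'rV[R]_n := coord_row u.-1 + coord_row u.

Lemma cut_row_path u (x : 'I_(n + n)) : (0 < u <= n)%N -> (x < n)%N ->
  (cut_row u *m v x) 0 0 = ((u == x.+1) || (u == x))%:R.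
Proof.
move=> u_bd ltx; rewrite col_psi_path // mulmxDl mxE !coord_row_mul.
rewrite (_ : u.-1 < n)%N; last lia.
have -> : (u == x.+1) = (u.-1 == x) by lia.
have [lt_u|le_u] := ltnP u n.
  by case: (eqVneq u.-1 x) => /= e1; case: (eqVneq u x) => /= e2;
    rewrite ?addr0 ?add0r //; lia.
by rewrite addr0; case: (eqVneq u x) => [?|]; rewrite ?orbF //; lia.
Qed.

(** Consecutive nonzero entries of a spoke have opposite signs and cancel; a single one survives
    exactly when [u] is the height. *)
Lemma cut_row_spoke u (x : 'I_(n + n)) : (0 < u <= n)%N -> (n <= x)%N ->
  ((cut_row u *m v x) 0 0 == 0) = (u != h (x - n)).
Proof.
move=> u_bd lex; rewrite col_psi_spoke // mulmxDl mxE !coord_row_mul.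
rewrite (_ : u.-1 < n)%N; last lia.
have := h_le (x - n); move: (h _) => b le_b.
have -> : (n - u.-1.+1 = n - u)%N by lia.
case: (ltngtP u b) => [lt_ub|lt_bu|<-].
- have lt_un : (u < n)%N by lia.
  rewrite lt_un (_ : u.-1 < b)%N; last lia.
  by rewrite -(@subnSK u n) // exprS mulN1r addNr eqxx.
- by rewrite (_ : (u.-1 < b)%N = false) ?add0r ?if_same ?eqxx //; lia.
by rewrite (_ : u.-1 < u)%N ?if_same ?addr0 ?signr_eq0 //; lia.
Qed.

(** In each case the edges after [i] up to [j] contain a path joining the ends of [i], made of path
    edges and spokes. *)
Lemma necklace_span_le (i j : 'I_(n + n)) : necklace_perm n h j = i ->
  v i \in set_span v [set b | 0 < cyclic_pos i b <= cyclic_pos i j]%N.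
Proof.
move=> /(necklace_perm_cases h_le h_ge h_mono n_gt0) ij.
have lti := ltn_ord i; have ltj := ltn_ord j.
set U := set_span v _.
have memU (x : 'I_(n + n)) :
    (if i <= j then i < x <= j else (i < x) || (x <= j))%N -> v x \in U.
  move=> ix; apply: mem_set_span; rewrite inE !cyclic_posE; move: ix.
  have := ltn_ord x.
  by case: (leqP i j); case: (leqP i x); lia.
have spokeU (x : 'I_(n + n)) : (n <= x)%N ->
    (if i <= j then i < x <= j else (i < x) || (x <= j))%N ->
    spoke (h (x - n)) \in U.
  by move=> lex ix; rewrite -col_psi_spoke ?memU.
have h0 : h 0 = n by have := h_ge n_gt0; have := h_le 0; lia.
have lt_n : (n < n + n)%N by lia.
(* From the vertex [i.+1] the path leads up to [n], and the spoke [n], of height [h 0 = n], returns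
   to [0]. *)
have top_spoke : (i < n)%N -> (n <= j)%N || (j < i)%N -> spoke i.+1 \in U.
  move=> ltin jn; rewrite (@mem_spoke U i.+1 n); [|lia|].
    have := spokeU (Ordinal lt_n) (leqnn n); rewrite /= subnn h0; apply.
    by case: (leqP i j); lia.
  by move=> x lt_x; apply: memU; case: (leqP i j); lia.
case: ij => [[i0 jn]|[]].
- apply: path_mem_spoke; [lia| |by apply: top_spoke; lia].
  by rewrite i0 spoke0 mem0v.
- case=> i_bd ij _; apply: path_mem_spoke; [lia| |by apply: top_spoke; lia].
  rewrite -(@mem_spoke U 0 i); [by rewrite spoke0 mem0v|lia|].
  by move=> x lt_x; apply: memU; case: (leqP i j); lia.
- case=> i_bd lej hj _; apply: path_mem_spoke; [lia| |by apply: top_spoke; lia].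
  by rewrite -hj; apply: spokeU => //; case: (leqP i j); lia.
- case=> lei ij hij; rewrite col_psi_spoke // -hij; apply: spokeU; first lia.
  by case: (leqP i j); lia.
case=> lei lej hij _; rewrite col_psi_spoke //.
have := h_le (i - n) => hn.
rewrite -(@mem_spoke U 0 (h (i - n))); [by rewrite spoke0 mem0v|lia|].
by move=> x lt_x; apply: memU; case: (leqP i j); lia.
Qed.

(** The edges strictly between [i] and [j] avoid some end of [i], and the cut at that vertex
    separates [i] from them. *)
Lemma necklace_span_lt (i j : 'I_(n + n)) : necklace_perm n h j = i ->
  v i \notin set_span v [set b | 0 < cyclic_pos i b < cyclic_pos i j]%N.
Proof.
move=> /(necklace_perm_cases h_le h_ge h_mono n_gt0) ij.
have lti := ltn_ord i; have ltj := ltn_ord j.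
set B := [set b | _].
have memB (x : 'I_(n + n)) : x \in B ->
    (if i <= j then i < x < j else (i < x) || (x < j))%N.
  rewrite inE !cyclic_posE; have := ltn_ord x.
  by case: (leqP i j); case: (leqP i x); lia.
have cut u : (0 < u <= n)%N ->
    (forall x : 'I_(n + n), x \in B -> (x < n)%N -> u != x.+1 /\ u != x) ->
    (forall x : 'I_(n + n), x \in B -> (n <= x)%N -> u != h (x - n)) ->
    (if (i < n)%N then (u == i.+1) || (u == i) else u == h (i - n)) ->
    v i \notin set_span v B.
  move=> u_bd pathB spokeB ui; apply: (@set_span_separated _ _ (cut_row u)).
    move=> x xB; have [ltx|lex] := ltnP x n.
      rewrite cut_row_path //.
      by have [/negPf-> /negPf->] := pathB x xB ltx.
    by apply/eqP; rewrite cut_row_spoke ?spokeB.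
  move: ui; have [ltin|lein] := ltnP i n => ui.
    by rewrite cut_row_path // ui oner_eq0.
  by rewrite cut_row_spoke // negbK.
case: ij => [[i0 jn]|[]].
(* The vertex avoided is [0], whose cut is, up to signs, the first coordinate. *)
- apply: (@set_span_separated _ _ (coord_row 0)).
    move=> x /memB; rewrite i0 jn /= => lt_x.
    rewrite col_psi_path ?coord_row_mul ?n_gt0; last lia.
    by rewrite (_ : (0 == x :> nat)%N = false) //; lia.
  by rewrite col_psi_path ?coord_row_mul ?i0 ?n_gt0 ?oner_eq0.
- case=> i_bd ij no_spoke; apply: (cut i); [lia| | |].
  + by move=> x /memB; case: (leqP i j); lia.
  + by move=> x _ lex; apply/eqP => /esym; apply: no_spoke.
  by rewrite eqxx orbT; case: ltnP; lia.
- case=> i_bd lej hj min_j; apply: (cut i); [lia| | |].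
  + by move=> x /memB; case: (leqP i j); lia.
  + move=> x /memB xB lex; apply/eqP => /esym /(min_j _ lex).
    by move: xB; case: (leqP i j); lia.
  by rewrite eqxx orbT; case: ltnP; lia.
- case=> lei ij hij; have hi := h_le (i - n); have := @h_ge (i - n).
  move=> hi'; apply: (cut (h (i - n))); [lia| | |].
  + by move=> x /memB; case: (leqP i j); lia.
  + by move=> x /memB; case: (leqP i j); lia.
  by rewrite eqxx; case: ltnP; lia.
case=> lei lej hij no_spoke; have hi := h_le (i - n).
apply: (cut (h (i - n))); [lia| | |].
- by move=> x /memB; case: (leqP i j); lia.
- move=> x /memB xB lex; apply/eqP => /esym; apply: no_spoke.
  by move: xB; case: (leqP i j); lia.
by rewrite eqxx; case: ltnP; lia.
Qed.

End DyckColumns.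

(** * Column heights of a Dyck matrix, and the conclusion *)

Lemma downward_closed_card (n : nat) (S : {set 'I_n}) (i : 'I_n) :
  (forall k l : 'I_n, (k <= l)%N -> l \in S -> k \in S) ->
  (i \in S) = (i < #|S|)%N.
Proof.
move=> down; have card_lt p : (p <= n)%N -> #|[set k : 'I_n | k < p]%N| = p.
  by move=> le_pn; rewrite -sum1dep_card (big_ord_narrow le_pn) sum1_card card_ord.
(* [S] either contains the initial segment up to [i] or is contained in the segment below [i]. *)
apply/idP/idP => [iS|]; last apply: contraTT => iS.
  rewrite -[X in (X <= _)%N](card_lt i.+1 (ltn_ord i)); apply: subset_leq_card.
  by apply/subsetP => k; rewrite inE => le_ki; apply: down iS.
rewrite -leqNgt -[X in (_ <= X)%N](card_lt i (ltnW (ltn_ord i))); apply: subset_leq_card.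
apply/subsetP => k kS; rewrite inE ltnNge; apply: contra iS => le_ik.
exact: down kS.
Qed.

(** The height of a column is its number of ones, which fill the bottom because the rows of zeros
    shorten downwards. *)
Lemma dyck_matrix_height (R : realType) (n : nat) (A : 'M[R]_n) :
  dyck_matrix A ->
  exists h : nat -> nat,
    [/\ forall t, (h t <= n)%N, forall t, (t < n -> n - t <= h t)%N,
        forall t t', (t <= t' -> h t' <= h t)%N
      & forall i j : 'I_n, A (rev_ord i) j = (i < h j)%N%:R].
Proof.
move=> [[lam lam_mono A_lam] A_diag].
pose S t := [set i : 'I_n | lam (rev_ord i) + t < n]%N.
have memS t (i : 'I_n) : (i \in S t) = (i < #|S t|)%N.
  apply: downward_closed_card => k l le_kl; rewrite !inE.
  have /andP[] : (lam (rev_ord k) <= lam (rev_ord l) <= n)%N.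
    by apply: lam_mono => /=; lia.
  lia.
have A_S (i j : 'I_n) : A (rev_ord i) j = (i < #|S j|)%N%:R.
  by rewrite A_lam -memS inE; case: ltnP.
exists (fun t => #|S t|); split=> // [t|t lt_tn|t t' le_tt].
- by rewrite -[leqRHS]card_ord max_card.
(* The diagonal entry in column [t] is nonzero, so the ones reach at least the diagonal. *)
- have := A_S (rev_ord (Ordinal lt_tn)) (Ordinal lt_tn); rewrite rev_ordK /=.
  case: ltnP => [|_ /A_diag]; rewrite /=; lia.
apply/subset_leq_card/subsetP => i; rewrite !inE; lia.
Qed.

Theorem theorem4p4 (R : realType) (n : nat) (hn : (0 < n)%N) (A : 'M[R]_n)
    (hA : dyck_matrix A) :
  exists2 sigma : decorated_perm (n + n),
    unique (decorated_perm_of (represented_bases (psi A))) sigma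
  & exists js : (n + n).-1.-tuple 'I_(n + n),
      let s := first_elt hn :: js in
      [/\ ufcycle sigma s, split_monotone s & ballot_prefixes s].
Proof.
have [h [h_le h_ge h_mono A_h]] := dyck_matrix_height hA.
have no_fix (j : 'I_(n + n)) : necklace_perm n h j != j.
  apply/eqP => /(necklace_perm_cases h_le h_ge h_mono hn).
  by case=> [|[]]; try case; lia.
have [|||sigma sigma_uniq sigmaE] :=
    @unique_decorated_perm_of R n (n + n) (psi A) _ (necklace_perm n h) no_fix.
- exact: col_psi_full.
- exact: necklace_span_le hn h_le h_ge h_mono A_h.
- exact: necklace_span_lt hn h_le h_ge h_mono A_h.
exists sigma => //.
(* The head of the necklace has the least key; a key below that of the path edge [0] would need a
   spoke of height [0], which [h_ge] excludes. *)
have [js size_js neckE] : exists2 js, size js = (n + n).-1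
    & necklace n h = first_elt hn :: js.
  have first_in := mem_necklace h (first_elt hn).
  have := size_necklace n h; have := necklace_sorted n h_mono.
  case: (necklace n h) first_in => // x js; rewrite inE => /predU1P[->|x_js].
    by move=> _ /(congr1 predn) sz; exists js.
  rewrite /= (path_sortedE ltn_trans) => /andP[/allP lt_x _] _.
  have := lt_x _ (map_f (fun x : 'I_(n + n) => key n h x) x_js).
  have [ltx|lex] := ltnP x n; first by rewrite /= key_lt_path.
  rewrite /= key_lt_spoke_path //; have := @h_ge (x - n)%N; have := ltn_ord x; lia.
have js_size : size js == (n + n).-1 by rewrite size_js.
exists (Tuple js_size) => /=; rewrite -neckE; split.
- apply/andP; split; last exact: necklace_uniq.
  rewrite sigmaE -(eq_fcycle (f := next (necklace n h))).
    exact/cycle_next/necklace_uniq.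
  by move=> x; rewrite permE.
- exact: necklace_split_monotone.
exact: necklace_ballot.
Qed.
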